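(* Let $\mathcal{Q} \subset \mathbb{P}^3$ be a smooth quadric, let $\mathfrak{f}$ be a line on $\mathcal{Q}$, let $d \geq 1$ be an integer, and let $C \subset \mathcal{Q}$ be a curve in the linear system $|d\mathfrak{f}|$. Then there are distinct lines $L_1, \ldots, L_m$ in the same ruling of $\mathcal{Q}$ as $\mathfrak{f}$ such that $C$ is defined by $$I_C = I_{\mathcal{Q}} + I_{L_1}^{d_1} \cdot \ldots \cdot I_{L_m}^{d_m},$$ where $d_i \geq 1$ for all $i$ and $d_1 + \ldots + d_m = d$.
   Context: $K$ is an algebraically closed field, $\mathbb{P}^3 = \mathbb{P}^3_K$ with homogeneous coordinate ring $R = K[x,y,z,t]$. A curve is a pure one-dimensional locally Cohen-Macaulay closed subscheme of $\mathbb{P}^3$. For a closed subscheme $X \subset \mathbb{P}^3$, $I_X \subset R$ denotes its saturated homogeneous ideal. $|d\mathfrak{f}|$ is the complete linear system of effective divisors on $\mathcal{Q}$ linearly equivalent to $d\mathfrak{f}$; such a divisor is regarded as a curve in $\mathbb{P}^3$. *)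

(* Defs.v *)
From mathcomp Require Import all_boot all_order all_algebra.
From mathcomp Require Export mpoly.

Set Implicit Arguments.
Unset Strict Implicit.
Unset Printing Implicit Defensive.

Import GRing.Theory.
Local Open Scope ring_scope.

Section ProjectiveSpace.

Variable K : closedFieldType.

Definition Rset : Type := {mpoly K[4]} -> Prop.

Implicit Types (I J Q C D L : Rset) (p a b g h : {mpoly K[4]}).

Definition subI I J : Prop := forall p, I p -> J p.
Definition eqI I J : Prop := forall p, I p <-> J p.

Definition is_ideal I : Prop :=
  [/\ I 0, forall a b, I a -> I b -> I (a + b)
     & forall a b, I b -> I (a * b)].

Definition ideal_gen (S : Rset) : Rset :=
  fun p => forall J, is_ideal J -> subI S J -> J p.

Definition principal g : Rset := ideal_gen (fun p => p = g).

Definition unit_ideal : Rset := fun _ => True.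

Definition ideal_add I J : Rset :=
  fun p => exists a b, [/\ I a, J b & p = a + b].

Definition ideal_mul I J : Rset :=
  ideal_gen (fun p => exists a b, [/\ I a, J b & p = a * b]).

Definition ideal_exp I (n : nat) : Rset := iter n (ideal_mul I) unit_ideal.

(* The elements of the homogeneous ideal of the same closed subscheme of P^3:
   p is a local section of I on each of the four standard affine charts. *)
Definition saturation I : Rset :=
  fun p => forall i : 'I_4, exists n : nat, I ('X_i ^+ n * p).

Definition homogeneous_ideal I : Prop :=
  is_ideal I /\ forall p (n : nat), I p -> I (pihomog mdeg n p).

(* A closed subscheme X of P^3 is represented by I_X: X |-> I_X is a bijection
   onto the saturated homogeneous ideals, the unit ideal being the empty
   subscheme; X is contained in Y iff subI I_Y I_X. *)
Definition closed_subscheme I : Prop :=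
  homogeneous_ideal I /\ subI (saturation I) I.

(* Closed points of P^3 are given by homogeneous coordinates. *)
Definition point (v : 'I_4 -> K) : Prop := exists i, v i != 0.

Definition on (v : 'I_4 -> K) I : Prop := forall p, I p -> p.@[v] = 0.

Definition smooth_quadric Q : Prop :=
  exists q : {mpoly K[4]},
    [/\ q \is 2.-homog, q != 0, eqI Q (principal q)
      & forall v, point v -> q.@[v] = 0 -> exists i, (q^`M(i)).@[v] != 0].

Definition line L : Prop :=
  exists l1 l2 : {mpoly K[4]},
    [/\ l1 \is 1.-homog, l2 \is 1.-homog,
        forall c1 c2 : K, c1 *: l1 + c2 *: l2 = 0 -> c1 = 0 /\ c2 = 0
      & eqI L (ideal_gen (fun p => p = l1 \/ p = l2))].

Definition line_on Q L : Prop := line L /\ subI Q L.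

(* A ruling of Q: a family of lines on Q, exactly one through each point. *)
Definition ruling Q (F : Rset -> Prop) : Prop :=
  (forall L, F L -> line_on Q L) /\
  forall v, point v -> on v Q ->
    exists L, [/\ F L, on v L & forall L', F L' -> on v L' -> eqI L' L].

Definition same_ruling Q L L' : Prop :=
  exists F, [/\ ruling Q F, F L & F L'].

(* Effective Cartier divisors on an integral surface Q: near each closed point
   v of Q, that is on some D_+(h), the ideal sheaf of C in Q is generated by a
   single g which is nonzero on Q. *)
Definition effective_divisor Q C : Prop :=
  [/\ closed_subscheme C, subI Q C
    & forall v, point v -> on v Q ->
      exists h g : {mpoly K[4]},
        [/\ (exists m, h \is m.-homog) /\ h.@[v] != 0,
            exists n, g \is n.-homog,
            C g, ~ Q g
          & forall p, C p ->
              exists k : nat, ideal_add Q (principal g) (h ^+ k * p)]].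

(* The sum of effective divisors: the ideal sheaves in O_Q are multiplied. *)
Definition div_add Q C D : Rset :=
  saturation (ideal_add Q (ideal_mul C D)).

Definition div_mul Q (d : nat) D : Rset := iter d (div_add Q D) unit_ideal.

(* The divisor cut out on Q by a form a. *)
Definition div_form Q a : Rset := saturation (ideal_add Q (principal a)).

(* C - D is the divisor of the rational function a / b on Q, written without
   subtraction as C + div b = D + div a. *)
Definition lin_equiv Q C D : Prop :=
  exists (n : nat) (a b : {mpoly K[4]}),
    [/\ a \is n.-homog, b \is n.-homog, ~ Q a, ~ Q b
      & eqI (div_add Q C (div_form Q b)) (div_add Q D (div_form Q a))].

(* The complete linear system |D| on Q. *)
Definition linear_system Q D C : Prop :=
  effective_divisor Q C /\ lin_equiv Q C D.

End ProjectiveSpace.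

Arguments unit_ideal {K}.

(* Main.v *)
Require Import Defs.
From HB Require Import structures.
From mathcomp Require Import all_boot all_order all_algebra.
From mathcomp Require Import zify ring.
From Stdlib Require Import FunctionalExtensionality PropExtensionality.

(** Write R = K[x,y,z,t].  Since f lies on the quadric,
    q = l0 l2 - l1 l3 with f = (l0, l1), and smoothness says exactly that the
    four linear forms l_j are independent ([quadric_normal_form]).  Hence the
    homogeneous coordinate ring R / (q) embeds in S = K[s,u,p,r], the Cox ring
    of P^1 x P^1, by l0 = sp, l1 = up, l2 = ur, l3 = sr.  Below s, u, p, r are
    the variables number 0, 1, 2, 3.  The embedding is induced by the ring
    morphism [cox], whose kernel is (q) ([cox_ker]) and whose image is spanned
    by the monomials with as many factors among s, u as among p, r
    ([cox_onto]).

    For F in S let contr F be the ideal of all g in R such that F divides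
    cox g.  It is saturated: if F divides both (sp)^n cox g and (ur)^m cox g, it
    divides cox g, because these monomials are coprime ([contr_saturation]).
    The divisors of the statement are all of this shape: f is p = 0 and d f is
    contr p^d ([div_mul_contr]), the divisor of a form b is contr (cox b)
    ([div_form_contr]).

    A linear equivalence C + div b = d f + div a then says that cox b divides
    (cox a) p^d and, writing (cox a) p^d = (cox b) F, that C = contr F
    ([lin_equiv_contr]); comparing bidegrees, F is a binary form of degree d in
    p and r.  As K is algebraically closed, F is a product of linear forms
    p - z r or r ([binary_factor]), which cut out the lines of the ruling
    containing f ([ruling_rline]).

    Finally let F be the product of the l_i^(d_i), with l_i a linear form in p
    and r and L_i the line l_i = 0, so that L_i = (s l_i, u l_i).  If F divides
    cox g, the quotient T has d more factors s, u than p, r in each of its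
    monomials, so F T is a sum of terms, each a product of d factors s l_i or
    u l_i, with each i used d_i times, and of a cofactor in the image of cox.  Thus
    cox g is the image of an element of the product of the ideals L_i^(d_i),
    which gives the formula for I_C ([contr_prod]). *)

Set Implicit Arguments.
Unset Strict Implicit.
Unset Printing Implicit Defensive.

Import GRing.Theory.
Local Open Scope ring_scope.

(** * Supports, projections and coprime monomials *)

Section MonomialLinear.
Variables (n : nat) (K : fieldType) (V : lmodType K).
Implicit Types (p q F T : {mpoly K[n]}) (m : 'X_{1..n}).

Definition mlin (h : 'X_{1..n} -> V) p : V := \sum_(m <- msupp p) p@_m *: h m.

(** Enlarging the range of summation lets polynomials of different supports
    share one range, as needed for linearity. *)
Lemma mlinE h (r : seq 'X_{1..n}) p : uniq r -> {subset msupp p <= r} ->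
  mlin h p = \sum_(m <- r) p@_m *: h m.
Proof.
move=> Ur sr; rewrite (bigID (mem (msupp p))) /= [X in _ + X]big1 ?addr0; last first.
  by move=> m /memN_msupp_eq0 ->; rewrite scale0r.
rewrite -big_filter; apply: perm_big; apply: uniq_perm; rewrite ?filter_uniq ?msupp_uniq //.
by move=> m; rewrite mem_filter; case: (boolP (m \in _)) => // /sr ->.
Qed.

Lemma mlin_is_linear h : linear (mlin h).
Proof.
move=> c p q; pose r := undup (msupp p ++ msupp q ++ msupp (c *: p + q)).
have sub (t : {mpoly K[n]}) : (forall m, m \in msupp t -> m \in r) ->
    mlin h t = \sum_(m <- r) t@_m *: h m.
  by move=> H; apply: mlinE; rewrite ?undup_uniq.
rewrite !sub => [|m Hm|m Hm|m Hm]; rewrite ?mem_undup ?mem_cat ?Hm ?orbT //.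
rewrite scaler_sumr -big_split; apply: eq_bigr => m _ /=.
by rewrite mcoeffD mcoeffZ scalerDl scalerA.
Qed.

HB.instance Definition _ h :=
  GRing.isLinear.Build K {mpoly K[n]} V _ (mlin h) (mlin_is_linear h).

Lemma mlinX h m : mlin h 'X_[m] = h m.
Proof. by rewrite /mlin msuppX big_seq1 mcoeffX eqxx scale1r. Qed.

End MonomialLinear.

Section Support.
Variables (n : nat) (K : fieldType).
Implicit Types (p q F G H T : {mpoly K[n]}) (m : 'X_{1..n}) (P : pred 'X_{1..n}).

Definition supp_in P p := forall m, m \in msupp p -> P m.

Lemma supp_in_ind P (Z : {mpoly K[n]} -> Prop) :
  Z 0 -> (forall p q, Z p -> Z q -> Z (p + q)) ->
  (forall c m, P m -> Z (c *: 'X_[m])) -> forall p, supp_in P p -> Z p.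
Proof.
move=> Z0 ZD ZX p Pp; rewrite (mpolyE p) big_seq.
by apply: (big_ind Z) => // m /Pp; apply: ZX.
Qed.

Lemma supp_in0 P : supp_in P 0.
Proof. by move=> m; rewrite msupp0. Qed.

Lemma supp_inX P m : P m -> supp_in P 'X_[m].
Proof. by move=> Pm k; rewrite msuppX inE => /eqP->. Qed.

Lemma supp_inD P p q : supp_in P p -> supp_in P q -> supp_in P (p + q).
Proof.
by move=> Pp Pq m /msuppD_le; rewrite mem_cat => /orP[/Pp|/Pq].
Qed.

Lemma supp_inZ P c p : supp_in P p -> supp_in P (c *: p).
Proof. by move=> Pp m /msuppZ_le /Pp. Qed.

Lemma supp_inM P1 P2 P p q :
  (forall m1 m2, P1 m1 -> P2 m2 -> P (m1 + m2)%MM) ->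
  supp_in P1 p -> supp_in P2 q -> supp_in P (p * q).
Proof.
move=> PD Pp Pq m /msuppM_le/allpairsP[[m1 m2] /= [/Pp h1 /Pq h2 ->]].
exact: PD.
Qed.

Lemma supp_inS P1 P2 p : (forall m, P1 m -> P2 m) -> supp_in P1 p -> supp_in P2 p.
Proof. by move=> P12 Pp m /Pp /P12. Qed.

(** With a suitable [P] this extracts graded pieces for gradings by integers of
    either sign, which measures on monomials do not provide. *)
Definition mproj P : {mpoly K[n]} -> {mpoly K[n]} :=
  mlin (fun m => if P m then 'X_[m] else 0).

HB.instance Definition _ P := GRing.Linear.on (mproj P).

Lemma mprojX P m : mproj P 'X_[m] = if P m then 'X_[m] else 0.
Proof. exact: mlinX. Qed.

Lemma mproj_supp P p : supp_in P (mproj P p).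
Proof.
rewrite /mproj /mlin; apply: (big_ind (supp_in P)) => [|x y|m _]; first exact: supp_in0.
  exact: supp_inD.
by apply: supp_inZ; case: ifP => Pm; [apply: supp_inX | apply: supp_in0].
Qed.

Lemma mproj_id P p : supp_in P p -> mproj P p = p.
Proof.
move=> Pp; rewrite [RHS]mpolyE; apply: eq_big_seq => m /Pp ->.
by [].
Qed.

(** Multiplication by a homogeneous [F] only shifts degrees, so it commutes with
    taking homogeneous components: in an equation H = F T with F and H
    homogeneous, T may be taken homogeneous. *)
Lemma mprojM P1 P2 P F T : supp_in P1 F ->
  (forall m1 m2, P1 m1 -> P (m1 + m2)%MM = P2 m2) ->
  mproj P (F * T) = F * mproj P2 T.
Proof.
move=> PF PD; move: F PF; apply: supp_in_ind => [|p q Hp Hq|c m Pm].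
- by rewrite !mul0r linear0.
- by rewrite !mulrDl linearD /= Hp Hq.
rewrite -!scalerAl linearZ /=; congr (_ *: _).
elim/mpolyind: T => [|c' m' p _ _ IH]; first by rewrite mulr0 !linear0 mulr0.
rewrite mulrDr !linearD /= mulrDr IH -scalerAr !linearZ /= -scalerAr -mpolyXD.
by rewrite !mprojX (PD _ _ Pm); case: ifP => _; rewrite ?mpolyXD // mulr0.
Qed.

Lemma pihomog_mproj d p : pihomog mdeg d p = mproj (fun m => mdeg m == d) p.
Proof.
rewrite pihomogE big_mkcond; apply: eq_bigr => m _ /=.
by case: ifP => _ //; rewrite scaler0.
Qed.

Lemma dhomog_supp d p : p \is d.-homog <-> supp_in (fun m => mdeg m == d) p.
Proof.
split=> [/dhomogP H m /H/eqP //|H]; apply/dhomogP => m /H /eqP //.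
Qed.

Definition coprime_mnm (m1 m2 : 'X_{1..n}) := forall i, m1 i = 0%N \/ m2 i = 0%N.

(** On the support of [p] each exponent of [m1] that is positive must come from
    [m] itself, since [m2] does not involve that variable. *)
Lemma coprime_mnm_dvd m1 m2 p q : coprime_mnm m1 m2 -> 'X_[m2] * p = 'X_[m1] * q ->
  exists t, p = 'X_[m1] * t.
Proof.
move=> cop E; exists (mlin (fun m => 'X_[m - m1]) p).
rewrite {1}(mpolyE p) /mlin mulr_sumr; apply: eq_big_seq => m pm.
rewrite -scalerAr -mpolyXD; congr (_ *: 'X_[_]).
rewrite addmC submK //.
have: (m2 + m)%MM \in msupp ('X_[m2] * p).
  by rewrite mulrC (perm_mem (msuppMX _ _)) map_f.
rewrite E mulrC (perm_mem (msuppMX _ _)) => /mapP[k _ /mnmP Ek].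
apply/mnm_lepP => i; move: (Ek i) (cop i); rewrite !mnmDE; lia.
Qed.

(** Cross-multiplying the two divisibilities reduces this to the previous lemma.
    It serves below in place of unique factorization in S. *)
Lemma coprime_mnm_gauss m1 m2 G H : coprime_mnm m1 m2 ->
  (exists t, 'X_[m1] * H = G * t) -> (exists t, 'X_[m2] * H = G * t) ->
  exists t, H = G * t.
Proof.
have X0 m : 'X_[m] != 0 :> {mpoly K[n]}.
  by rewrite -msupp_eq0 msuppX.
move=> cop [t1 E1] [t2 E2]; have [G0|G0] := eqVneq G 0.
  exists 0; apply/eqP; move/eqP: E1; rewrite G0 !mul0r mulf_eq0.
  by rewrite (negPf (X0 m1)).
have [|t Et] := @coprime_mnm_dvd m1 m2 t1 t2 cop.
  by apply: (mulfI G0); rewrite mulrCA -E1 [RHS]mulrCA -E2 mulrCA.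
exists t; apply: (mulfI (X0 m1)).
by rewrite E1 Et mulrCA.
Qed.

End Support.

(** * The Segre map *)

Notation i0 := (@Ordinal 4 0 isT).
Notation i1 := (@Ordinal 4 1 isT).
Notation i2 := (@Ordinal 4 2 isT).
Notation i3 := (@Ordinal 4 3 isT).

Lemma big_ord4 (T : Type) (idx : T) (op : Monoid.law idx) (F : 'I_4 -> T) :
  \big[op/idx]_(i < 4) F i = op (op (op (F i0) (F i1)) (F i2)) (F i3).
Proof.
rewrite 4!big_ord_recr big_ord0 Monoid.mul1m.
by congr (op (op (op (F _) (F _)) (F _)) (F _)); apply: val_inj.
Qed.

Lemma ord4P (P : 'I_4 -> Prop) : P i0 -> P i1 -> P i2 -> P i3 -> forall i, P i.
Proof.
move=> P0 P1 P2 P3 [[|[|[|[|//]]]] lt_i4].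
- by rewrite (_ : Ordinal _ = i0) //; apply: val_inj.
- by rewrite (_ : Ordinal _ = i1) //; apply: val_inj.
- by rewrite (_ : Ordinal _ = i2) //; apply: val_inj.
by rewrite (_ : Ordinal _ = i3) //; apply: val_inj.
Qed.

Definition mk4 (a b c d : nat) : 'X_{1..4} := [multinom [tuple a; b; c; d]].

Lemma mk4E a b c d : ((mk4 a b c d i0 = a) * (mk4 a b c d i1 = b) *
  (mk4 a b c d i2 = c) * (mk4 a b c d i3 = d))%type.
Proof. by rewrite /mk4 !multinomE !(tnth_nth 0%N). Qed.

Lemma mnm4P (m1 m2 : 'X_{1..4}) : m1 i0 = m2 i0 -> m1 i1 = m2 i1 ->
  m1 i2 = m2 i2 -> m1 i3 = m2 i3 -> m1 = m2.
Proof. by move=> *; apply/mnmP; apply: ord4P. Qed.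

Lemma mdeg4 (m : 'X_{1..4}) : mdeg m = (m i0 + m i1 + m i2 + m i3)%N.
Proof. by rewrite mdegE big_ord4. Qed.

(** Degrees in s, u and in p, r. *)
Definition bideg (i j : nat) : pred 'X_{1..4} :=
  fun m => (m i0 + m i1 == i)%N && (m i2 + m i3 == j)%N.

(** Weight 0 characterizes the image of the Segre map, weight d the cofactors of
    a binary form of degree d in p, r inside that image. *)
Definition wt (d : nat) : pred 'X_{1..4} :=
  fun m => (m i0 + m i1 == m i2 + m i3 + d)%N.

Section Segre.
Variable K : fieldType.
Implicit Types (g p F G H T : {mpoly K[4]}).

(** The images s p, u p, u r, s r of the four coordinates. *)
Definition seg (i : 'I_4) : {mpoly K[4]} :=
  'X_[tnth [tuple mk4 1 0 1 0; mk4 0 1 1 0; mk4 0 1 0 1; mk4 1 0 0 1] i].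

Lemma segE : ((seg i0 = 'X_[mk4 1 0 1 0]) * (seg i1 = 'X_[mk4 0 1 1 0]) *
  (seg i2 = 'X_[mk4 0 1 0 1]) * (seg i3 = 'X_[mk4 1 0 0 1]))%type.
Proof. by rewrite /seg !(tnth_nth 0%MM). Qed.

Definition segre : {mpoly K[4]} -> {mpoly K[4]} := comp_mpoly [tuple seg i | i < 4].
HB.instance Definition _ := GRing.LRMorphism.copy segre (comp_mpoly [tuple seg i | i < 4]).

Lemma segre_scale c g : segre (c *: g) = c *: segre g.
Proof. exact: linearZ. Qed.

Definition mseg (m : 'X_{1..4}) :=
  mk4 (m i0 + m i3) (m i1 + m i2) (m i0 + m i1) (m i2 + m i3).

Lemma segreX m : segre 'X_[m] = 'X_[mseg m].
Proof.
rewrite /segre comp_mpolyX big_ord4 /= !tnth_mktuple !segE !mpolyXn -!mpolyXD.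
by congr 'X_[_]; apply: mnm4P; rewrite !mnmDE !mulmnE !mk4E; lia.
Qed.

(** Modulo x0 x2 = x1 x3 each fibre of [mseg] contains exactly one monomial not
    divisible by x0 x2; this is that monomial, computed from its image. *)
Definition mcan (m : 'X_{1..4}) :=
  let b := minn (m i1) (m i2) in let a := (m i2 - b)%N in
  mk4 a b (m i1 - b) (m i0 - a).

Lemma segre_can m : wt 0 m -> segre 'X_[mcan m] = 'X_[m].
Proof.
rewrite segreX /wt => /eqP E; congr 'X_[_].
by apply: mnm4P; rewrite /mseg /mcan !mk4E; lia.
Qed.

Definition qseg : {mpoly K[4]} := 'X_i0 * 'X_i2 - 'X_i1 * 'X_i3.

(** The linear map that sends a monomial of S to its reduced preimage is a left
    inverse of the Segre map modulo [qseg]: on a monomial, the difference is a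
    multiple of (x0 x2)^k - (x1 x3)^k. *)
Lemma segre_ker g : segre g = 0 -> exists t, g = t * qseg.
Proof.
pose cn := mlin (fun m => 'X_[mcan m] : {mpoly K[4]}).
suff H : exists t, g - cn (segre g) = t * qseg.
  by move=> g0; move: H; rewrite g0 /cn linear0 subr0.
elim/mpolyind: g => [|c m g _ _ [t Et]].
  by exists 0; rewrite /segre linear0 /cn linear0 mul0r subr0.
suff [t' Et'] : exists t, 'X_[m] - cn (segre 'X_[m]) = t * qseg.
  exists (c *: t' + t); rewrite mulrDl -Et -scalerAl -Et'.
  rewrite rmorphD /= segre_scale /cn linearD linearZ /= scalerBr.
  by rewrite addrACA opprD.
(* x0 x2 divides the monomial exactly k times *)
rewrite segreX /cn mlinX; pose k := minn (m i0) (m i2).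
pose m' := mk4 (m i0 - k) (m i1) (m i2 - k) (m i3).
have -> : 'X_[m] = 'X_[m'] * ('X_i0 * 'X_i2) ^+ k :> {mpoly K[4]}.
  rewrite -mpolyXD mpolyXn -mpolyXD; congr 'X_[_]; apply: mnm4P;
  by rewrite !mnmDE mulmnE !mk4E mnmDE !mnm1E /=; lia.
have -> : 'X_[mcan (mseg m)] = 'X_[m'] * ('X_i1 * 'X_i3) ^+ k :> {mpoly K[4]}.
  rewrite -mpolyXD mpolyXn -mpolyXD; congr 'X_[_]; apply: mnm4P;
  by rewrite !mnmDE mulmnE /mcan /mseg !mk4E mnmDE !mnm1E /=; lia.
rewrite -mulrBr subrXX -/qseg mulrCA mulrC.
by eexists.
Qed.

Lemma segre_q : segre qseg = 0.
Proof.
rewrite rmorphB !rmorphM /= !segreX -!mpolyXD; apply/eqP; rewrite subr_eq0.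
by apply/eqP; congr 'X_[_]; apply: mnm4P; rewrite !mnmDE !mk4E !mnm1E.
Qed.

End Segre.

(** * The map to the Cox ring in adapted coordinates *)

(** The weight of a monomial is its degree in s, u minus its degree in p, r;
    [wt d] is weight d, and [nwt d] is weight -d. *)
Definition nwt d : pred 'X_{1..4} := fun m => (m i0 + m i1 + d == m i2 + m i3)%N.

Section Bidegree.
Variable K : fieldType.
Implicit Types (F G : {mpoly K[4]}).

Lemma bidegD i j i' j' m1 m2 : bideg i j m1 -> bideg i' j' m2 ->
  bideg (i + i') (j + j') (m1 + m2)%MM.
Proof.
rewrite /bideg !mnmDE => /andP[/eqP? /eqP?] /andP[/eqP? /eqP?].
by apply/andP; split; apply/eqP; lia.
Qed.

Lemma supp_bidegM i j i' j' F G : supp_in (bideg i j) F ->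
  supp_in (bideg i' j') G -> supp_in (bideg (i + i') (j + j')) (F * G).
Proof. by apply: supp_inM => m1 m2; apply: bidegD. Qed.

Lemma supp_bidegX i j F k : supp_in (bideg i j) F ->
  supp_in (bideg (k * i) (k * j)) (F ^+ k).
Proof.
move=> hF; elim: k => [|k IH]; last by rewrite exprS !mulSn; apply: supp_bidegM.
by rewrite expr0 -mpolyX0; apply: supp_inX; rewrite /bideg !mnm0E.
Qed.

Lemma nwt_wt d F G : supp_in (nwt d) F -> supp_in (wt d) G -> supp_in (wt 0) (F * G).
Proof. by apply: supp_inM => m1 m2; rewrite /wt /nwt !mnmDE; lia. Qed.

End Bidegree.

Lemma comp_mpolyA (K : comNzRingType) n k l (u : n.-tuple {mpoly K[k]})
    (v : k.-tuple {mpoly K[l]}) (g : {mpoly K[n]}) :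
  (g \mPo u) \mPo v = g \mPo [tuple tnth u i \mPo v | i < n].
Proof.
elim/mpolyind: g => [|c m g _ _ IH]; first by rewrite !linear0.
rewrite !linearD !linearZ /= IH; congr (_ *: _ + _).
rewrite !comp_mpolyX rmorph_prod; apply: eq_bigr => i _.
by rewrite rmorphXn /= tnth_mktuple.
Qed.

Section Coordinates.
Variables (K : fieldType) (A : 'M[K]_4).
Hypothesis uA : A \in unitmx.
Implicit Types (g h F G H T : {mpoly K[4]}).

Definition lform (B : 'M[K]_4) j : {mpoly K[4]} := \sum_i B j i *: 'X_i.

Definition quad : {mpoly K[4]} :=
  lform A i0 * lform A i2 - lform A i1 * lform A i3.

(** In the coordinates [lform A j] this is the Segre map. *)
Definition cox : {mpoly K[4]} -> {mpoly K[4]} :=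
  comp_mpoly [tuple lform (invmx A) i \mPo [tuple seg K j | j < 4] | i < 4].
HB.instance Definition _ := GRing.LRMorphism.copy cox
  (comp_mpoly [tuple lform (invmx A) i \mPo [tuple seg K j | j < 4] | i < 4]).

Definition subst (B : 'M[K]_4) g := g \mPo [tuple lform B i | i < 4].

Lemma lform_dhomog B j : lform B j \is 1.-homog.
Proof. by apply: rpred_sum => i _; apply: rpredZ; rewrite dhomogX /= mdeg1. Qed.

Lemma lform_comp B C j : subst C (lform B j) = lform (B *m C) j.
Proof.
rewrite /subst /lform linear_sum /=.
under eq_bigr => i _ do rewrite linearZ /= comp_mpolyXU -tnth_nth tnth_mktuple scaler_sumr.
rewrite exchange_big; apply: eq_bigr => k _ /=.
by rewrite mxE scaler_suml; apply: eq_bigr => i _; rewrite scalerA.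
Qed.

Lemma lform1 j : lform 1%:M j = 'X_j :> {mpoly K[4]}.
Proof.
rewrite /lform (bigD1 j) //= mxE eqxx scale1r big1 ?addr0 // => i ne.
by rewrite mxE eq_sym (negPf ne) scale0r.
Qed.

Lemma subst_comp B C g : B *m C = 1%:M -> subst C (subst B g) = g.
Proof.
move=> E; rewrite /subst comp_mpolyA -[RHS]comp_mpoly_id; congr (_ \mPo _).
by apply: eq_from_tnth => i; rewrite !tnth_mktuple -/(subst _ _) lform_comp E lform1.
Qed.

Lemma coxE g : cox g = segre (subst (invmx A) g).
Proof.
rewrite /cox /segre /subst comp_mpolyA; congr (_ \mPo _).
by apply: eq_from_tnth => i; rewrite !tnth_mktuple.
Qed.

Lemma cox_subst g : cox (subst A g) = segre g.
Proof. by rewrite coxE subst_comp // mulmxV. Qed.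

Lemma subst_X j : subst A 'X_j = lform A j.
Proof. by rewrite /subst comp_mpolyXU -tnth_nth tnth_mktuple. Qed.

Lemma cox_lform j : cox (lform A j) = seg K j.
Proof. by rewrite -subst_X cox_subst /segre comp_mpolyXU -tnth_nth tnth_mktuple. Qed.

Lemma cox_quad : cox quad = 0.
Proof.
have -> : quad = subst A (qseg K).
  by rewrite /quad /qseg /subst rmorphB !rmorphM /= -!/(subst _ _) !subst_X.
by rewrite cox_subst segre_q.
Qed.

Lemma cox_ker g : cox g = 0 -> exists t, g = t * quad.
Proof.
rewrite coxE => /segre_ker[t Et]; exists (subst A t).
rewrite -(@subst_comp (invmx A) A g) ?mulVmx // Et.
by rewrite /quad /qseg /subst rmorphM rmorphB !rmorphM /= -!/(subst _ _) !subst_X.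
Qed.

Lemma cox_onto T : supp_in (wt 0) T -> exists g, cox g = T.
Proof.
move: T; apply: supp_in_ind => [|p q [g <-] [h <-]|c m wm].
- by exists 0; rewrite linear0.
- by exists (g + h); rewrite linearD.
by exists (c *: subst A 'X_[mcan m]); rewrite linearZ /= cox_subst segre_can.
Qed.

Lemma X_lform i : 'X_i = \sum_j invmx A i j *: lform A j.
Proof.
rewrite -lform1 -(mulVmx uA) -lform_comp {2}/lform /subst linear_sum.
by apply: eq_bigr => j _; rewrite linearZ /= -/(subst _ _) subst_X.
Qed.

(** A form of degree n restricts to a section of O(n,n). *)
Lemma cox_bideg n g : g \is n.-homog -> supp_in (bideg n n) (cox g).
Proof.
have segb j : supp_in (bideg 1 1) (seg K j).
  by apply: supp_inX; move: j; apply: ord4P; rewrite !(tnth_nth 0%MM) /bideg !mk4E.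
have coxb i : supp_in (bideg 1 1) (cox 'X_i).
  rewrite X_lform linear_sum /=; apply: (big_ind (supp_in _)).
  - exact: supp_in0.
  - by move=> *; apply: supp_inD.
  by move=> j _; rewrite linearZ /= cox_lform; apply: supp_inZ.
move/dhomog_supp; move: g; apply: supp_in_ind => [|p q|c m /eqP dm].
- by rewrite linear0; apply: supp_in0.
- by rewrite linearD /=; apply: supp_inD.
rewrite linearZ /= mpolyXE_id big_ord4 !rmorphM !rmorphXn /=; apply: supp_inZ.
have -> : n = (m i0 * 1 + m i1 * 1 + m i2 * 1 + m i3 * 1)%N by rewrite -dm mdeg4; lia.
by do !apply: supp_bidegM; apply: supp_bidegX.
Qed.

Lemma cox_wt g : supp_in (wt 0) (cox g).
Proof.
elim/mpolyind: g => [|c m g _ _ IH]; first by rewrite linear0; apply: supp_in0.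
rewrite linearD; apply: supp_inD IH.
rewrite linearZ /=; apply: supp_inZ.
apply: (@supp_inS _ _ (bideg (mdeg m) (mdeg m))).
  by move=> k /andP[/eqP e1 /eqP e2]; apply/eqP; lia.
by apply: cox_bideg; rewrite dhomogX.
Qed.

End Coordinates.

(** * Ideals *)

Section Ideals.
Variable K : closedFieldType.
Implicit Types (I J : Rset K) (g h p a b : {mpoly K[4]}).

(** Extensionality turns equality of ideals into Leibniz equality, so that
    descriptions of ideals can be rewritten. *)
Lemma eqI_eq I J : eqI I J -> I = J.
Proof.
by move=> IJ; apply: functional_extensionality => p; apply: propositional_extensionality.
Qed.

Lemma subI_eq I J : subI I J -> subI J I -> I = J.
Proof. by move=> IJ JI; apply: eqI_eq => p; split; [apply: IJ | apply: JI]. Qed.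

Lemma ideal0 I : is_ideal I -> I 0. Proof. by case. Qed.
Lemma idealD I a b : is_ideal I -> I a -> I b -> I (a + b).
Proof. by case=> _ H _; apply: H. Qed.
Lemma idealMl I a b : is_ideal I -> I b -> I (a * b).
Proof. by case=> _ _ H; apply: H. Qed.
Lemma idealZ I c a : is_ideal I -> I a -> I (c *: a).
Proof. by move=> idI Ia; rewrite -mul_mpolyC; apply: idealMl. Qed.
Lemma idealMn I a n : is_ideal I -> I a -> I (a *+ n).
Proof. by move=> idI Ia; rewrite -mulr_natl; apply: idealMl. Qed.
Lemma ideal_sum I (T : Type) (r : seq T) (P : pred T) (F : T -> {mpoly K[4]}) :
  is_ideal I -> (forall i, P i -> I (F i)) -> I (\sum_(i <- r | P i) F i).
Proof.
move=> idI IF; apply: (big_ind I) => //; first exact: ideal0.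
by move=> x y; apply: idealD.
Qed.

Lemma ideal_gen_ideal (S : Rset K) : is_ideal (ideal_gen S).
Proof.
split=> [J idJ _|a b Ha Hb J idJ SJ|a b Hb J idJ SJ]; first exact: ideal0.
  by apply: idealD => //; [apply: Ha | apply: Hb].
by apply: idealMl => //; apply: Hb.
Qed.

Lemma ideal_gen_sub (S : Rset K) : subI S (ideal_gen S).
Proof. by move=> p Sp J _; apply. Qed.

Lemma ideal_mul_ideal I J : is_ideal (ideal_mul I J).
Proof. exact: ideal_gen_ideal. Qed.

Lemma ideal_mulP I J a b : I a -> J b -> ideal_mul I J (a * b).
Proof. by move=> Ia Jb; apply: ideal_gen_sub; exists a, b. Qed.

Lemma ideal_mul_min I J D : is_ideal D ->
  (forall a b, I a -> J b -> D (a * b)) -> subI (ideal_mul I J) D.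
Proof. by move=> idD IJ p Hp; apply: Hp => // _ [a [b [Ia Jb ->]]]; apply: IJ. Qed.

Lemma principalP g p : principal g p <-> exists t, p = t * g.
Proof.
split=> [Hp|[t ->]]; last first.
  by apply: (idealMl t (ideal_gen_ideal _)); apply: ideal_gen_sub.
apply: (Hp (fun p => exists t, p = t * g))=> [|_ ->]; last by exists 1; rewrite mul1r.
split=> [|_ _ [t ->] [t' ->]|a _ [t ->]]; first by exists 0; rewrite mul0r.
  by exists (t + t'); rewrite mulrDl.
by exists (a * t); rewrite mulrA.
Qed.

Lemma gen2P g h p :
  ideal_gen (fun p => p = g \/ p = h) p <-> exists a b, p = a * g + b * h.
Proof.
split=> [Hp|[a [b ->]]].
  apply: (Hp (fun p => exists a b, p = a * g + b * h))=> [|_ [->|->]].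
  - split=> [|_ _ [a [b ->]] [a' [b' ->]]|c _ [a [b ->]]].
    + by exists 0, 0; rewrite !mul0r addr0.
    + by exists (a + a'), (b + b'); ring.
    by exists (c * a), (c * b); ring.
  - by exists 1, 0; ring.
  by exists 0, 1; ring.
apply: (idealD (ideal_gen_ideal _)).
  by apply: (idealMl a (ideal_gen_ideal _)); apply: ideal_gen_sub; left.
by apply: (idealMl b (ideal_gen_ideal _)); apply: ideal_gen_sub; right.
Qed.

Lemma ideal_add_min I J D : is_ideal D -> subI I D -> subI J D ->
  subI (ideal_add I J) D.
Proof.
by move=> idD ID JD _ [a [b [Ia Jb ->]]]; apply: idealD; [| apply: ID | apply: JD].
Qed.

Lemma ideal_addl I J : is_ideal J -> subI I (ideal_add I J).
Proof. by move=> idJ p Ip; exists p, 0; rewrite addr0; split=> //; apply: ideal0. Qed.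

Lemma ideal_addr I J : is_ideal I -> subI J (ideal_add I J).
Proof. by move=> idI p Jp; exists 0, p; rewrite add0r; split=> //; apply: ideal0. Qed.

Lemma ideal_add_ideal I J : is_ideal I -> is_ideal J -> is_ideal (ideal_add I J).
Proof.
move=> idI idJ; split; first exact: (ideal_addl idJ (ideal0 idI)).
  move=> _ _ [a [b [Ia Jb ->]]] [a' [b' [Ia' Jb' ->]]].
  by exists (a + a'), (b + b'); rewrite addrACA;
    split; [apply: (idealD idI) | apply: (idealD idJ) |].
move=> c _ [a [b [Ia Jb ->]]]; exists (c * a), (c * b); rewrite mulrDr.
by split; [apply: (idealMl c idI) | apply: (idealMl c idJ) |].
Qed.

Lemma sub_saturation I : subI I (saturation I).
Proof. by move=> p Ip i; exists 0%N; rewrite expr0 mul1r. Qed.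

Lemma saturationS I J : subI I J -> subI (saturation I) (saturation J).
Proof. by move=> IJ p Ip i; have [n /IJ Jn] := Ip i; exists n. Qed.

(** The elements with a power in the colon ideal (I : g) form an ideal, by the
    binomial theorem. *)
Lemma colon_addX I g x y : is_ideal I ->
  (exists n, I (x ^+ n * g)) -> (exists n, I (y ^+ n * g)) ->
  exists n, I ((x + y) ^+ n * g).
Proof.
move=> idI [m Im] [n In]; exists (m + n)%N.
rewrite exprDn mulr_suml; apply: ideal_sum => // i _.
rewrite mulrnAl; apply: idealMn => //.
case: (leqP n i) => ni.
  rewrite -(subnK ni) exprD.
  rewrite (_ : _ * _ * g = x ^+ (m + n - (i - n + n)) * y ^+ (i - n) * (y ^+ n * g)); last by ring.
  exact: idealMl.
have -> : (m + n - i = (n - i) + m)%N by lia.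
rewrite exprD (_ : _ * _ * g = x ^+ (n - i) * y ^+ i * (x ^+ m * g)); last by ring.
exact: idealMl.
Qed.

(** Saturation, defined with the given coordinates, may thus be tested with any
    linear forms. *)
Lemma saturation_lform I g B j : is_ideal I -> saturation I g ->
  exists n, I (lform B j ^+ n * g).
Proof.
move=> idI satg; rewrite /lform.
apply: (big_ind (fun x => exists n, I (x ^+ n * g))).
- by exists 1%N; rewrite expr1 mul0r; apply: ideal0.
- by move=> x y; apply: colon_addX.
move=> i _; have [n In] := satg i; exists n.
by rewrite exprZn -scalerAl; apply: idealZ.
Qed.

End Ideals.

(** * Ideals contracted from the Cox ring *)

Section Contraction.
Variables (K : closedFieldType) (A : 'M[K]_4).
Hypothesis uA : A \in unitmx.
Implicit Types (g h F G H T : {mpoly K[4]}).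
Local Notation Q := (principal (quad A)).
Local Notation cox := (cox A).

(** For F bihomogeneous and nonzero this is the ideal in R of the divisor
    F = 0 on the quadric. *)
Definition contr F : Rset K := fun g => exists T, cox g = F * T.

Lemma quadP g : Q g <-> cox g = 0.
Proof.
split=> [/principalP[t ->]|/cox_ker/principalP]; last exact.
by rewrite rmorphM /= cox_quad // mulr0.
Qed.

Lemma contr_ideal F : is_ideal (contr F).
Proof.
split=> [|a b [T ET] [T' ET']|a b [T ET]].
- by exists 0; rewrite linear0 mulr0.
- by exists (T + T'); rewrite linearD /= ET ET' mulrDr.
by exists (cox a * T); rewrite rmorphM /= ET mulrCA.
Qed.

Lemma quad_ideal : is_ideal Q. Proof. exact: ideal_gen_ideal. Qed.

Lemma quad_contr F : subI Q (contr F).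
Proof. by move=> g /quadP E; exists 0; rewrite E mulr0. Qed.

Lemma mul_contr F G : subI (ideal_mul (contr F) (contr G)) (contr (F * G)).
Proof.
apply: ideal_mul_min; first exact: contr_ideal.
move=> a b [T ET] [T' ET']; exists (T * T').
by rewrite rmorphM /= ET ET'; ring.
Qed.

(** The images s p of l0 and u r of l2 are coprime. *)
Lemma contr_lform F g : (forall j, exists n, contr F (lform A j ^+ n * g)) ->
  contr F g.
Proof.
move=> H; have [n [T ET]] := H i0; have [n' [T' ET']] := H i2.
move: ET ET'; rewrite !rmorphM !rmorphXn /= !cox_lform // !segE !mpolyXn => ET ET'.
apply: (coprime_mnm_gauss (m1 := (mk4 1 0 1 0 *+ n)%MM) (m2 := (mk4 0 1 0 1 *+ n')%MM)).
- by apply: ord4P; rewrite !mulmnE !mk4E; lia.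
- by exists T.
by exists T'.
Qed.

Lemma contr_saturation F : subI (saturation (contr F)) (contr F).
Proof.
move=> g satg; apply: contr_lform => j.
by apply: saturation_lform => //; apply: contr_ideal.
Qed.

(** The image of [cox] has weight 0, so the weight d part of the cofactor
    suffices. *)
Lemma contr_wt d F g : supp_in (nwt d) F -> contr F g ->
  exists T, supp_in (wt d) T /\ cox g = F * T.
Proof.
move=> hF [T ET]; exists (mproj (wt d) T); split; first exact: mproj_supp.
rewrite -(mproj_id (cox_wt uA (g := g))) ET; apply: mprojM hF _ => m1 m2.
rewrite /wt /nwt !mnmDE => /eqP; lia.
Qed.

Lemma cox_eq_quad g h : cox g = cox h -> Q (g - h).
Proof. by move=> E; apply/quadP; rewrite linearB /= E subrr. Qed.

End Contraction.

(** * Divisors on the quadric *)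

Section Divisors.
Variables (K : closedFieldType) (A : 'M[K]_4).
Hypothesis uA : A \in unitmx.
Implicit Types (g h F G H T : {mpoly K[4]}) (C D : Rset K).
Local Notation Q := (principal (quad A)).
Local Notation cox := (cox A).
Local Notation contr := (contr A).
Local Notation f := (ideal_gen (fun p => p = lform A i0 \/ p = lform A i1)).

Lemma cox_nwt g : supp_in (nwt 0) (cox g).
Proof. by apply: supp_inS (cox_wt uA (g := g)) => m; rewrite /wt /nwt; lia. Qed.

Lemma div_form_contr b : div_form Q b = contr (cox b).
Proof.
apply: subI_eq => g.
  move=> satg; apply: (contr_saturation uA); apply: saturationS satg.
  apply: ideal_add_min; [exact: contr_ideal | exact: quad_contr |].
  move=> _ /principalP[t ->]; exists (cox t).
  by rewrite rmorphM mulrC.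
case/(contr_wt uA (cox_nwt (g := b))) => T [hT ET]; apply: sub_saturation.
have [t Et] := cox_onto uA hT; exists (g - t * b), (t * b); split.
- by apply: (cox_eq_quad uA); rewrite rmorphM /= Et ET mulrC.
- by apply/principalP; exists t.
by rewrite subrK.
Qed.

Lemma X2_nwt d : supp_in (nwt d) ('X_i2 ^+ d : {mpoly K[4]}).
Proof.
by rewrite mpolyXn; apply: supp_inX; rewrite /nwt !mulmnE !mnm1E; apply/eqP => /=; lia.
Qed.

Lemma fline_contr : subI f (contr 'X_i2).
Proof.
move=> _ /gen2P[a [b ->]]; apply: (idealD (contr_ideal _ _)).
  apply: (idealMl a (contr_ideal _ _)); exists 'X_i0; rewrite cox_lform // segE -mpolyXD.
  by congr 'X_[_]; apply: mnm4P; rewrite mnmDE !mnm1E mk4E.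
apply: (idealMl b (contr_ideal _ _)); exists 'X_i1; rewrite cox_lform // segE -mpolyXD.
by congr 'X_[_]; apply: mnm4P; rewrite mnmDE !mnm1E mk4E.
Qed.

(** The product of f = (sp, up) with contr p^d may be smaller than contr p^(d+1) but
    has the same saturation: for g = p^(d+1) T every l_j g lies in the product,
    because (ur) p = (up) r and (sr) p = (sp) r. *)
Lemma div_mul_contr d : div_mul Q d f = contr ('X_i2 ^+ d).
Proof.
elim: d => [|d IH].
  by apply: eqI_eq => g; split=> // _; exists (cox g); rewrite expr0 mul1r.
rewrite /div_mul iterS -/(div_mul Q d f) IH; apply: subI_eq => g.
  move=> satg; apply: (contr_saturation uA); apply: saturationS satg.
  apply: ideal_add_min; [exact: contr_ideal | exact: quad_contr |].
  apply: ideal_mul_min; first exact: contr_ideal.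
  move=> a b /fline_contr ha hb; rewrite exprS; apply: mul_contr => //.
  exact: ideal_mulP.
case/(contr_wt uA (@X2_nwt _)) => T [hT ET].
have fl0 : f (lform A i0) by apply: ideal_gen_sub; left.
have fl1 : f (lform A i1) by apply: ideal_gen_sub; right.
have key j (l k : 'I_4) : k = i2 \/ k = i3 -> f (lform A l) ->
    seg K j * 'X_i2 = seg K l * 'X_k ->
    ideal_add Q (ideal_mul f (contr ('X_i2 ^+ d))) (lform A j * g).
  move=> hk fl Ejl.
  have h1 : supp_in (wt 0) ('X_k * ('X_i2 ^+ d * T)).
    apply: (supp_inM (P1 := nwt 1) (P2 := wt 1)) => [m1 m2||].
    - by rewrite /wt /nwt !mnmDE; lia.
    - by apply: supp_inX; rewrite /nwt !mnm1E; case: hk => ->.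
    apply: supp_inM (@X2_nwt d) hT => m1 m2.
    by rewrite /wt /nwt !mnmDE; lia.
  have [t Et] := cox_onto uA h1.
  exists (lform A j * g - lform A l * t), (lform A l * t); split; last by rewrite subrK.
    apply: (cox_eq_quad uA); rewrite !rmorphM /= !(cox_lform uA) ET Et exprS.
    by rewrite !mulrA Ejl.
  apply: (ideal_mulP fl); exists ('X_k * T); rewrite Et; ring.
have all j : ideal_add Q (ideal_mul f (contr ('X_i2 ^+ d))) (lform A j * g).
  move: j; apply: ord4P.
  - by apply: (key i0 i0 i2) => //; left.
  - by apply: (key i1 i1 i2) => //; left.
  - apply: (key i2 i1 i3) => //; first by right.
    by rewrite !segE -!mpolyXD; congr 'X_[_]; apply: mnm4P; rewrite !mnmDE !mnm1E !mk4E.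
  apply: (key i3 i0 i3) => //; first by right.
  by rewrite !segE -!mpolyXD; congr 'X_[_]; apply: mnm4P; rewrite !mnmDE !mnm1E !mk4E.
move=> i; exists 1%N; rewrite expr1 (X_lform uA i) mulr_suml.
have addI : is_ideal (ideal_add Q (ideal_mul f (contr ('X_i2 ^+ d)))).
  exact: (ideal_add_ideal (quad_ideal A) (ideal_mul_ideal _ _)).
by apply: (ideal_sum _ addI) => j _; rewrite -scalerAl; apply: (idealZ _ addI).
Qed.

(** The equation of divisors gives (cox b) (cox c) in (cox a) p^d S for c in C,
    and conversely that each element of contr (cox a p^d) lies, after
    multiplication by powers of the coordinates, in b C + Q.  The second fact,
    applied to (cox a) p^d s^d and (cox a) p^d u^d, shows that cox b divides
    (cox a) p^d. *)
Lemma lin_equiv_contr C d : closed_subscheme C -> subI Q C ->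
  lin_equiv Q C (div_mul Q d f) ->
  exists F, [/\ F != 0, supp_in (bideg 0 d) F & C = contr F].
Proof.
move=> [[idC _] satC] QC [n [a [b [ha hb nQa nQb]]]].
rewrite div_mul_contr !div_form_contr => /eqI_eq E.
pose P : {mpoly K[4]} := 'X_i2 ^+ d; rewrite -/P in E.
have a0 : cox a != 0 by apply/eqP => /(quadP uA).
have b0 : cox b != 0 by apply/eqP => /(quadP uA).
have P0 : P != 0 by rewrite /P mpolyXn -msupp_eq0 msuppX.
have hP : supp_in (bideg 0 d) P.
  by rewrite /P mpolyXn; apply: supp_inX; rewrite /bideg !mulmnE !mnm1E;
    apply/andP; split; apply/eqP => /=; lia.
have hN : supp_in (nwt d) (cox a * P).
  by apply: supp_inM (cox_nwt (g := a)) (@X2_nwt d) => m1 m2; rewrite /nwt !mnmDE; lia.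
have CbaP c : C c -> exists T, cox c * cox b = cox a * P * T.
  move=> Cc; suff [T] : contr (P * cox a) (c * b).
    by rewrite rmorphM /= => ->; exists T; ring.
  apply: (contr_saturation uA).
  have: div_add Q C (contr (cox b)) (c * b).
    apply: sub_saturation; apply: (ideal_addr (quad_ideal A)).
    by apply: (ideal_mulP Cc); exists 1; rewrite mulr1.
  rewrite E; apply: saturationS; apply: ideal_add_min.
  - exact: contr_ideal.
  - exact: quad_contr.
  exact: mul_contr.
(* b C + Q, in a form that is visibly an ideal *)
pose bC : Rset K := fun g => exists2 c, C c & cox g = cox b * cox c.
have bC_ideal : is_ideal bC.
  split.
  - by exists 0; [apply: ideal0 | rewrite !linear0 mulr0].
  - move=> x y [c Cc Ec] [c' Cc' Ec']; exists (c + c'); first exact: idealD.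
    by rewrite !linearD /= Ec Ec' mulrDr.
  move=> x y [c Cc Ec]; exists (x * c); first exact: idealMl.
  by rewrite !rmorphM /= Ec mulrCA.
have aP_sat g : contr (cox a * P) g -> saturation bC g.
  case/(contr_wt uA hN) => T [hT ET].
  have: div_add Q (contr P) (contr (cox a)) g.
    apply: sub_saturation.
    have hPT : supp_in (wt 0) (P * T) by apply: nwt_wt hT; apply: X2_nwt.
    have [t Et] := cox_onto uA hPT.
    exists (g - t * a), (t * a); split; last by rewrite subrK.
      by apply: (cox_eq_quad uA); rewrite rmorphM /= ET Et; ring.
    by apply: ideal_mulP; [exists T | exists 1; rewrite mulr1].
  rewrite -E; apply: saturationS; apply: (ideal_add_min bC_ideal).
    by move=> x /(quadP uA) Ex; exists 0; [apply: ideal0 | rewrite Ex linear0 mulr0].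
  apply: (ideal_mul_min bC_ideal) => c x Cc /(contr_wt uA (cox_nwt (g := b)))[T' [hT' ET']].
  have [t' Et'] := cox_onto uA hT'; exists (t' * c); first exact: idealMl.
  by rewrite !rmorphM /= ET' Et'; ring.
(* cox a * P has weight -d; s^d and u^d bring it into the image of cox *)
have b_dvd_mon (i : 'I_4) : i = i0 \/ i = i1 ->
    exists T, 'X_i ^+ d * (cox a * P) = cox b * T.
  move=> hi.
  have hw : supp_in (wt 0) (cox a * P * 'X_i ^+ d).
    apply: nwt_wt hN _; rewrite mpolyXn; apply: supp_inX.
    by rewrite /wt !mulmnE !mnm1E; case: hi => -> /=; lia.
  have [g Eg] := cox_onto uA hw; rewrite mulrC -Eg.
  suff: contr (cox b) g by [].
  apply: (contr_saturation uA); apply: (saturationS (I := bC)).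
    by move=> x [c _ Ec]; exists (cox c).
  by apply: aP_sat; exists ('X_i ^+ d).
have [F EF] : exists F, cox a * P = cox b * F.
  apply: (coprime_mnm_gauss (m1 := (U_(i0) *+ d)%MM) (m2 := (U_(i1) *+ d)%MM)).
  - by apply: ord4P; rewrite !mulmnE !mnm1E /=; lia.
  - by rewrite -mpolyXn; apply: b_dvd_mon; left.
  by rewrite -mpolyXn; apply: b_dvd_mon; right.
have bi_aP : supp_in (bideg n (n + d)) (cox a * P).
  by have := supp_bidegM (cox_bideg uA ha) hP; rewrite addn0.
exists F; split.
- apply: contraNneq (mulf_neq0 a0 P0) => F0.
  by rewrite EF F0 mulr0.
- suff -> : F = mproj (bideg 0 d) F by apply: mproj_supp.
  apply: (mulfI b0); rewrite -EF -{1}(mproj_id bi_aP) EF.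
  apply: mprojM (cox_bideg uA hb) _ => m1 m2.
  by rewrite /bideg !mnmDE => /andP[/eqP ? /eqP ?]; lia.
apply: subI_eq => g.
  move=> /CbaP[T ET]; exists T; apply: (mulfI b0).
  by rewrite mulrC ET EF; ring.
move=> [T ET]; apply: satC => i.
have /aP_sat/(_ i)[N [c Cc Ec]] : contr (cox a * P) (b * g).
  by exists T; rewrite rmorphM /= ET EF; ring.
exists N; rewrite -(subrK c ('X_i ^+ N * g)); apply: (idealD idC _ Cc); apply: QC.
apply: (cox_eq_quad uA); apply: (mulfI b0); rewrite -Ec !rmorphM /=; ring.
Qed.

End Divisors.

(** * Factorization of binary forms *)

Section BinaryForms.
Variable K : closedFieldType.
Implicit Types (F : {mpoly K[4]}) (g : {poly K}).

(** Points of P^1 are encoded by [option K], [None] being the point at infinity;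
    the linear forms chosen are pairwise non-proportional, so that distinct
    indices will give distinct lines. *)
Definition bform (o : option K) : {mpoly K[4]} :=
  if o is Some z then 'X_i2 - z *: 'X_i3 else 'X_i3.

Definition homogenize d g : {mpoly K[4]} :=
  \sum_(k < d.+1) g`_k *: ('X_i2 ^+ k * 'X_i3 ^+ (d - k)).

Lemma homogenizeD d g h : homogenize d (g + h) = homogenize d g + homogenize d h.
Proof. by rewrite -big_split; apply: eq_bigr => k _; rewrite coefD scalerDl. Qed.

Lemma homogenizeZ d c g : homogenize d (c *: g) = c *: homogenize d g.
Proof. by rewrite scaler_sumr; apply: eq_bigr => k _; rewrite coefZ scalerA. Qed.

Lemma homogenizeXn d k : (k <= d)%N -> homogenize d 'X^k = 'X_i2 ^+ k * 'X_i3 ^+ (d - k).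
Proof.
move=> kd; have lt : (k < d.+1)%N by [].
rewrite /homogenize (bigD1 (Ordinal lt)) //= coefXn eqxx scale1r big1 ?addr0 // => j ne.
rewrite coefXn (_ : (j == k :> nat) = false) ?scale0r //.
by apply: contraNF ne => /eqP E; apply/eqP/val_inj.
Qed.

Lemma homogenize_bump d g : (size g <= d.+1)%N -> homogenize d.+1 g = 'X_i3 * homogenize d g.
Proof.
move=> sg; rewrite /homogenize big_ord_recr /= (nth_default _ sg) scale0r addr0 mulr_sumr.
apply: eq_bigr => k _; rewrite -scalerAr; congr (_ *: _).
by rewrite subSn ?exprS; [ring | rewrite -ltnS].
Qed.

Lemma homogenize_mulX d g : homogenize d.+1 (g * 'X) = 'X_i2 * homogenize d g.
Proof.
rewrite /homogenize big_ord_recl coefMX /= scale0r add0r mulr_sumr.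
apply: eq_bigr => k _; rewrite coefMX /= /bump /= add1n subSS -scalerAr; congr (_ *: _).
by rewrite exprS mulrA.
Qed.

(** A root z of [g] splits off p - z r; when the degree of [g] is less than d,
    the homogenization is divisible by r instead. *)
Lemma homogenize_factor d g : (size g <= d.+1)%N -> g != 0 ->
  exists (c : K) (s : seq (option K)),
    [/\ c != 0, size s = d & homogenize d g = c *: \prod_(o <- s) bform o].
Proof.
elim: d g => [|d IH] g sg g0.
  exists g`_0, [::]; split=> //; last by rewrite /homogenize big_ord1 big_nil !expr0 mulr1.
  by apply: contraNneq g0 => E; rewrite (size1_polyC sg) E.
case: (leqP (size g) d.+1) => sg'.
  have [c [s [c0 ss E]]] := IH g sg' g0; exists c, (None :: s); split=> //=.
    by rewrite ss.
  by rewrite homogenize_bump // E big_cons /= scalerAr.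
have /closed_rootP[z /factor_theorem[h Eg]] : size g != 1%N by lia.
have h0 : h != 0 by apply: contraNneq g0 => E; rewrite Eg E mul0r.
have sh : (size h <= d.+1)%N.
  by move: sg; rewrite Eg size_Mmonic ?monicXsubC // size_XsubC addn2.
have [c [s [c0 ss E]]] := IH h sh h0; exists c, (Some z :: s); split=> //=.
  by rewrite ss.
have -> : g = h * 'X + (- z) *: h by rewrite Eg mulrBr mulrC -mul_polyC polyCN; ring.
by rewrite homogenizeD homogenizeZ homogenize_mulX homogenize_bump // big_cons /=
  (scalerAr c) -E mulrBl scaleNr -scalerAl.
Qed.

Lemma binary_factor d F : supp_in (bideg 0 d) F -> F != 0 ->
  exists (c : K) (s : seq (option K)), [/\ c != 0, size s = d & F = c *: \prod_(o <- s) bform o].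
Proof.
move=> hF F0; pose g := mlin (fun m => 'X^(m i2) : {poly K}) F.
have [sg Eg] : (size g <= d.+1)%N /\ homogenize d g = F.
  rewrite /g; move: F hF {F0 g}; apply: supp_in_ind.
  - rewrite linear0 size_poly0; split=> //.
    by rewrite /homogenize big1 // => k _; rewrite coef0 scale0r.
  - move=> p q [sp Ep] [sq Eq]; rewrite linearD homogenizeD Ep Eq; split=> //.
    by rewrite (leq_trans (size_polyD _ _)) // geq_max sp.
  move=> c m /andP[/eqP e1 /eqP e2].
  rewrite linearZ /= mlinX homogenizeZ; split.
    by rewrite (leq_trans (size_scale_leq _ _)) // size_polyXn; lia.
  rewrite homogenizeXn; last by lia.
  rewrite !mpolyXn -mpolyXD; congr (_ *: 'X_[_]).
  by apply: mnm4P; rewrite !mnmDE !mulmnE !mnm1E /=; lia.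
rewrite -Eg; apply: homogenize_factor => //.
apply: contraNneq F0 => g0; rewrite -Eg g0.
by rewrite /homogenize big1 // => k _; rewrite coef0 scale0r.
Qed.

End BinaryForms.

(** * The ruling and products of its lines *)

Section Lines.
Variables (K : closedFieldType) (A : 'M[K]_4).
Hypothesis uA : A \in unitmx.
Implicit Types (g h F G H T : {mpoly K[4]}) (I J : Rset K) (o : option K).
Local Notation Q := (principal (quad A)).
Local Notation cox := (cox A).
Local Notation contr := (contr A).
Local Notation l := (lform A).

(** The line cut out by [bform o]: its ideal is generated by the elements that
    map to s and u times that form. *)
Definition rgen0 o := if o is Some z then l i0 - z *: l i3 else l i3.
Definition rgen1 o := if o is Some z then l i1 - z *: l i2 else l i2.
Definition rline o : Rset K := ideal_gen (fun p => p = rgen0 o \/ p = rgen1 o).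

Lemma cox_rgen0 o : cox (rgen0 o) = 'X_i0 * bform o.
Proof.
have coxBZ a b (z : K) : cox (a - z *: b) = cox a - z *: cox b.
  by rewrite linearB linearZ.
case: o => [z|] /=; rewrite ?coxBZ !(cox_lform uA) !segE.
  rewrite mulrBr -scalerAr -!mpolyXD; congr ('X_[_] - _ *: 'X_[_]);
  by apply: mnm4P; rewrite mnmDE !mnm1E mk4E.
by rewrite -mpolyXD; congr 'X_[_]; apply: mnm4P; rewrite mnmDE !mnm1E mk4E.
Qed.

Lemma cox_rgen1 o : cox (rgen1 o) = 'X_i1 * bform o.
Proof.
have coxBZ a b (z : K) : cox (a - z *: b) = cox a - z *: cox b.
  by rewrite linearB linearZ.
case: o => [z|] /=; rewrite ?coxBZ !(cox_lform uA) !segE.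
  rewrite mulrBr -scalerAr -!mpolyXD; congr ('X_[_] - _ *: 'X_[_]);
  by apply: mnm4P; rewrite mnmDE !mnm1E mk4E.
by rewrite -mpolyXD; congr 'X_[_]; apply: mnm4P; rewrite mnmDE !mnm1E mk4E.
Qed.

Lemma rline_ideal o : is_ideal (rline o).
Proof. exact: ideal_gen_ideal. Qed.

Lemma rline_contr o : subI (rline o) (contr (bform o)).
Proof.
move=> _ /gen2P[a [b ->]]; exists (cox a * 'X_i0 + cox b * 'X_i1).
by rewrite linearD /= !rmorphM /= cox_rgen0 cox_rgen1; ring.
Qed.

(** A zero of [bform o] with s = 1, u = 0. *)
Definition bzero o : 'I_4 -> K := fun i =>
  tnth (if o is Some z then [tuple 1; 0; z; 1] else [tuple 1; 0; 1; 0]) i.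

Lemma rline_inj o o' : rline o = rline o' -> o = o'.
Proof.
move=> E; have: rline o' (rgen0 o) by rewrite -E; apply: ideal_gen_sub; left.
case/rline_contr => T /(congr1 (meval (bzero o'))).
rewrite cox_rgen0 !mevalM mevalXU.
case: o {E} => [z|]; case: o' => [z'|] /=;
  rewrite ?mevalB ?mevalZ !mevalXU /bzero !(tnth_nth 0) /=
    ?mulr1 ?mul1r ?subrr ?mul0r ?mulr0 ?subr0 //.
- by move/eqP; rewrite subr_eq0 => /eqP->.
- by move/eqP; rewrite oner_eq0.
by move/eqP; rewrite oner_eq0.
Qed.

(** [I] is large enough to contain, up to Q, all g with cox g a multiple of [G],
    when [G] has weight -n; stated on monomials because these can be split
    between the factors of a product of ideals. *)
Definition fits I G n := forall m, wt n m -> exists2 g, I g & cox g = G * 'X_[m].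

Lemma fits_supp I G n T : is_ideal I -> fits I G n -> supp_in (wt n) T ->
  exists2 g, I g & cox g = G * T.
Proof.
move=> idI fI; move: T; apply: supp_in_ind => [|p q [g Ig Eg] [h Ih Eh]|c m wm].
- by exists 0; [apply: ideal0 | rewrite linear0 mulr0].
- by exists (g + h); [apply: idealD | rewrite linearD /= Eg Eh mulrDr].
have [g Ig Eg] := fI m wm.
by exists (c *: g); [apply: idealZ | rewrite linearZ /= Eg scalerAr].
Qed.

Lemma fits_unit : fits unit_ideal 1 0.
Proof.
move=> m wm; have [g Eg] := cox_onto uA (supp_inX (K := K) (P := wt 0) wm).
by exists g; rewrite ?mul1r.
Qed.

(** A monomial of weight n + k contains n factors s or u; they form a monomial
    of weight n, and the rest has weight k. *)
Lemma fits_mul I J G H n k : fits I G n -> fits J H k ->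
  fits (ideal_mul I J) (G * H) (n + k).
Proof.
move=> fI fJ m /eqP wm; pose a := minn (m i0) n; pose m1 := mk4 a (n - a) 0 0.
have lem : (m1 <= m)%MM by apply/mnm_lepP; apply: ord4P; rewrite mk4E; lia.
have [|g Ig Eg] := fI m1; first by rewrite /wt !mk4E; apply/eqP; lia.
have [|h Ih Eh] := fJ (m - m1)%MM.
  by rewrite /wt !mnmBE !mk4E; apply/eqP; lia.
exists (g * h); first exact: ideal_mulP.
by rewrite rmorphM /= Eg Eh -{2}(submK lem) mpolyXD; ring.
Qed.

Lemma fits_exp I G n k : fits I G n -> fits (ideal_exp I k) (G ^+ k) (k * n).
Proof.
move=> fI; elim: k => [|k IH]; first exact: fits_unit.
by rewrite exprS mulSn; apply: fits_mul.
Qed.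

Lemma fits_rline o : fits (rline o) (bform o) 1.
Proof.
move=> m /eqP wm; have idL := rline_ideal o.
have [m0|m0] := posnP (m i0).
  have lem : (U_(i1) <= m)%MM by apply/mnm_lepP; apply: ord4P; rewrite mnm1E /=; lia.
  have /(supp_inX (K := K))/(cox_onto uA)[t Et] : wt 0 (m - U_(i1))%MM.
    by rewrite /wt !mnmBE !mnm1E; apply/eqP => /=; lia.
  exists (t * rgen1 o); first by apply: (idealMl t idL); apply: ideal_gen_sub; right.
  by rewrite rmorphM /= cox_rgen1 Et -{2}(submK lem) mpolyXD; ring.
have lem : (U_(i0) <= m)%MM by apply/mnm_lepP; apply: ord4P; rewrite mnm1E /=; lia.
have /(supp_inX (K := K))/(cox_onto uA)[t Et] : wt 0 (m - U_(i0))%MM.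
  by rewrite /wt !mnmBE !mnm1E; apply/eqP => /=; lia.
exists (t * rgen0 o); first by apply: (idealMl t idL); apply: ideal_gen_sub; left.
by rewrite rmorphM /= cox_rgen0 Et -{2}(submK lem) mpolyXD; ring.
Qed.

Lemma unit_ideal_ideal : is_ideal (@unit_ideal K). Proof. by []. Qed.

(** One inclusion is multiplicativity of [contr]; for the other, [fits] lifts the
    weight component of the cofactor. *)
Lemma contr_prod n (L : 'I_n -> option K) (e : 'I_n -> nat) c : c != 0 ->
  contr (c *: \prod_(i < n) bform (L i) ^+ e i) =
  ideal_add Q (\big[@ideal_mul K/unit_ideal]_(i < n) ideal_exp (rline (L i)) (e i)).
Proof.
move=> c0; set G := \prod_(i < n) _; set B := \big[_/_]_(i < n) _.
have cG T : (c *: G) * T = G * (c *: T) by rewrite -scalerAl scalerAr.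
have idB : is_ideal B.
  apply: (big_ind (@is_ideal K)) => [|I J _ _|i _]; first exact: unit_ideal_ideal.
    exact: ideal_mul_ideal.
  by case: (e i) => [|k]; [apply: unit_ideal_ideal | apply: ideal_mul_ideal].
have contrM I J F H : subI I (contr F) -> subI J (contr H) ->
    subI (ideal_mul I J) (contr (F * H)).
  move=> hI hJ; apply: ideal_mul_min; first exact: contr_ideal.
  by move=> a b /hI ha /hJ hb; apply: mul_contr; apply: ideal_mulP ha hb.
have unitC : subI unit_ideal (contr 1) by move=> g _; exists (cox g); rewrite mul1r.
have BG : subI B (contr G).
  apply: (big_ind2 (fun I F => subI I (contr F))) => [|I F J H|i _]; first exact: unitC.
    exact: contrM.
  elim: (e i) => [|k IH]; first exact: unitC.
  rewrite exprS; apply: contrM IH.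
  exact: rline_contr.
have fB : fits B G (\sum_(i < n) e i).
  apply: (big_ind3 fits) => [|I F k J H k'|i _].
  - exact: fits_unit.
  - exact: fits_mul.
  by rewrite -[X in fits _ _ X]muln1; apply/fits_exp/fits_rline.
have hG : supp_in (nwt (\sum_(i < n) e i)) (c *: G).
  apply: supp_inZ; apply: (big_ind2 (fun F k => supp_in (nwt k) F)) => [|F k H k'|i _].
  - by rewrite -mpolyX0; apply: supp_inX; rewrite /nwt !mnm0E.
  - by apply: supp_inM => m1 m2; rewrite /nwt !mnmDE; lia.
  have hb : supp_in (bideg 0 1) (bform (L i)).
    have h2 : supp_in (bideg 0 1) ('X_i2 : {mpoly K[4]}) by apply: supp_inX; rewrite /bideg !mnm1E.
    have h3 : supp_in (bideg 0 1) ('X_i3 : {mpoly K[4]}) by apply: supp_inX; rewrite /bideg !mnm1E.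
    case: (L i) => [z|] //=; apply: supp_inD => //.
    by rewrite -scaleNr; apply: supp_inZ.
  apply: supp_inS (supp_bidegX (k := e i) hb) => m /andP[/eqP e1 /eqP e2].
  by apply/eqP; lia.
apply: subI_eq => g.
  case/(contr_wt uA hG) => T [hT ET].
  have [h Bh Eh] := fits_supp idB fB (supp_inZ (c := c) hT).
  exists (g - h), h; split; [|exact: Bh|by rewrite subrK].
  by apply: (cox_eq_quad uA); rewrite ET Eh cG.
move: g; apply: ideal_add_min; [exact: contr_ideal | exact: quad_contr |].
move=> g /BG[T ET]; exists (c^-1 *: T).
by rewrite cG scalerA mulfV // scale1r.
Qed.

Lemma rgen_independent o c1 c2 : c1 *: rgen0 o + c2 *: rgen1 o = 0 -> c1 = 0 /\ c2 = 0.
Proof.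
move/(congr1 cox); rewrite linear0 linearD !linearZ /= cox_rgen0 cox_rgen1 => E.
(* points where the binary form takes the value 1 *)
pose v a b : 'I_4 -> K := fun i =>
  tnth (if o is Some z then [tuple a; b; z + 1; 1] else [tuple a; b; 1; 1]) i.
have bv a b : (bform o).@[v a b] = 1.
  case: o @v {E} => [z|] v /=; rewrite ?mevalB ?mevalZ !mevalXU /v !(tnth_nth 0) //=.
  by rewrite mulr1 addrAC subrr add0r.
have E' a b : c1 * a + c2 * b = 0.
  move: (congr1 (meval (v a b)) E); rewrite meval0 mevalD !mevalZ !mevalM bv !mevalXU !mulr1.
  by rewrite /v !(tnth_nth 0); case: (o).
by move: (E' 1 0) (E' 0 1); rewrite !mulr1 !mulr0 addr0 add0r.
Qed.

Lemma rgen_homog o : rgen0 o \is 1.-homog /\ rgen1 o \is 1.-homog.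
Proof.
case: o => [z|] /=; split; rewrite ?lform_dhomog //;
by apply: rpredB; rewrite ?rpredZ ?lform_dhomog.
Qed.

Lemma rline_line_on o : line_on Q (rline o).
Proof.
split.
  exists (rgen0 o), (rgen1 o); have [h0 h1] := rgen_homog o; split=> //.
  exact: rgen_independent.
move=> _ /principalP[t ->]; apply: (idealMl t (rline_ideal o)); apply/gen2P.
case: o => [z|] /=; last by exists (- l i1), (l i0); rewrite /quad; ring.
by exists (l i2), (- l i3); rewrite /quad -!mul_mpolyC; ring.
Qed.

Lemma on_rline v o : on v (rline o) <-> (rgen0 o).@[v] = 0 /\ (rgen1 o).@[v] = 0.
Proof.
split=> [von|[e0 e1] _ /gen2P[a [b ->]]].
  by split; apply: von; apply: ideal_gen_sub; [left | right].
by rewrite mevalD !mevalM e0 e1 !mulr0 addr0.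
Qed.

(** Through v = (a0, a1, a2, a3) on the quadric passes the line with parameter
    z = a0 / a3 = a1 / a2, the two ratios agreeing because a0 a2 = a1 a3; it is the
    line at infinity of the family when a2 = a3 = 0. *)
Lemma ruling_rline : ruling Q (fun L => exists o, L = rline o).
Proof.
split=> [_ [o ->]|v pv vQ]; first exact: rline_line_on.
pose a j := (l j).@[v].
have a_eq0 : ~ (forall j, a j = 0).
  move=> a0; have [i] := pv; apply/negP/negPn/eqP.
  rewrite -(mevalXU v) (X_lform uA) raddf_sum /=; apply: big1 => j _.
  by rewrite mevalZ -/(a j) a0 mulr0.
have qa : a i0 * a i2 = a i1 * a i3.
  apply/eqP; rewrite -subr_eq0 -!mevalM -mevalB; apply/eqP.
  by apply: vQ; apply: (ideal_gen_sub (erefl (quad A))).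
have onE o : on v (rline o) <->
    if o is Some z then a i0 = z * a i3 /\ a i1 = z * a i2 else a i2 = 0 /\ a i3 = 0.
  have sub0 x y : x - y = 0 <-> x = y :> K by split=> [/subr0_eq|->]; rewrite ?subrr.
  rewrite on_rline; case: o => [z|] /=; last by split=> [][].
  by rewrite !mevalB !mevalZ -!/(a _) !sub0.
suff [o ho uo] : exists2 o, on v (rline o) & forall o', on v (rline o') -> o' = o.
  exists (rline o); split; [by exists o | exact: ho |].
  by move=> _ [o' ->] /uo ->.
have [a2|a2] := eqVneq (a i2) 0; have [a3|a3] := eqVneq (a i3) 0.
- exists None; first by apply/onE.
  move=> [z|] // /onE[e0 e1]; case: a_eq0; apply: ord4P => //.
    by rewrite e0 a3 mulr0.
  by rewrite e1 a2 mulr0.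
- exists (Some (a i0 / a i3)).
    apply/onE; split; first by rewrite mulfVK.
    rewrite a2 mulr0; move/eqP: qa; rewrite a2 mulr0 eq_sym mulf_eq0 (negPf a3) orbF.
    by move/eqP.
  move=> [z|] /onE[e0 e1]; first by rewrite e0 mulfK.
  by rewrite e1 eqxx in a3.
- exists (Some (a i1 / a i2)).
    apply/onE; split; last by rewrite mulfVK.
    by apply: (mulIf a2); rewrite qa a3 !mulr0 mul0r.
  move=> [z|] /onE[e0 e1]; first by rewrite e1 mulfK.
  by rewrite e0 eqxx in a2.
exists (Some (a i1 / a i2)).
  apply/onE; split; last by rewrite mulfVK.
  by apply: (mulIf a2); rewrite qa mulrAC mulfVK.
move=> [z|] /onE[e0 e1]; first by rewrite e1 mulfK.
by rewrite e0 eqxx in a2.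
Qed.

End Lines.

(** * Normal form of a smooth quadric containing a line *)

Section NormalForm.
Variable K : closedFieldType.
Implicit Types (p : {mpoly K[4]}) (A : 'M[K]_4).

Lemma dhomog1_sum p : p \is 1.-homog -> p = \sum_i p@_U_(i) *: 'X_i.
Proof.
move/dhomog_supp; move: p; apply: supp_in_ind => [|p q Ep Eq|c m].
- by rewrite big1 // => i _; rewrite mcoeff0 scale0r.
- rewrite {1}Ep {1}Eq -big_split; apply: eq_bigr => i _.
  by rewrite mcoeffD scalerDl.
case/mdeg1P => j /eqP ->; rewrite (bigD1 j) //= big1 ?addr0 => [|i ne].
  by rewrite mcoeffZ mcoeffXU eqxx mulr1.
by rewrite mcoeffZ mcoeffXU eq_sym (negPf ne) mulr0 scale0r.
Qed.

Lemma meval_mderivM0 (i : 'I_4) (a b : {mpoly K[4]}) v :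
  a.@[v] = 0 -> b.@[v] = 0 -> ((a * b)^`M(i)).@[v] = 0.
Proof. by move=> a0 b0; rewrite mderivM mevalD !mevalM a0 b0 mul0r mulr0 addr0. Qed.

(** At a common zero of the four linear forms, l0 l2 - l1 l3 and all its partial
    derivatives vanish. *)
Lemma quad_unitmx A :
  (forall v, point v -> (quad A).@[v] = 0 -> exists i, ((quad A)^`M(i)).@[v] != 0) ->
  A \in unitmx.
Proof.
move=> smooth; rewrite unitmxE unitfE -det_tr; apply/det0P => -[v v0 vA].
have lv j : (lform A j).@[fun i => v 0 i] = 0.
  move/matrixP: vA => /(_ 0 j); rewrite !mxE => vAj.
  rewrite -[RHS]vAj raddf_sum; apply: eq_bigr => i _ /=.
  by rewrite mevalZ mevalXU mxE mulrC.
have [||i] := smooth (fun i => v 0 i).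
- by have /rV0Pn := v0.
- by rewrite mevalB !mevalM !lv !mul0r subrr.
by rewrite mderivB mevalB !meval_mderivM0 ?subrr ?eqxx.
Qed.

(** Since q lies in f = (l0, l1), q = a l0 + b l1; taking the component of degree
    2, the cofactors a and b may be taken linear. *)
Lemma quadric_normal_form (Q f : Rset K) : smooth_quadric Q -> line_on Q f ->
  exists A, [/\ A \in unitmx, Q = principal (quad A)
    & f = ideal_gen (fun p => p = lform A i0 \/ p = lform A i1)].
Proof.
move=> [q [hq q0 /eqI_eq -> smooth]] [[l0 [l1 [h0 h1 _ /eqI_eq ->]]] qf].
have /gen2P[a [b Eq]] := qf q (ideal_gen_sub (erefl q)).
pose a1 := pihomog mdeg 1 a; pose b1 := pihomog mdeg 1 b.
have ha : a1 \is 1.-homog := pihomogP _ _ _.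
have hb : b1 \is 1.-homog := pihomogP _ _ _.
have {}Eq : q = l0 * a1 - l1 * - b1.
  move: (hq); rewrite homog_piE => /eqP <-; rewrite Eq /a1 /b1 !pihomog_mproj linearD /=.
  rewrite mulrN opprK ![_ * l0]mulrC ![_ * l1]mulrC.
  congr (_ + _);
    [apply: mprojM ((dhomog_supp _ _).1 h0) _ | apply: mprojM ((dhomog_supp _ _).1 h1) _];
  by move=> m1 m2 /eqP E; rewrite mdegD E.
pose A : 'M[K]_4 := \matrix_(j, i) (nth 0 [:: l0; l1; a1; - b1] j)@_U_(i).
have lA (j : 'I_4) : nth 0 [:: l0; l1; a1; - b1] j \is 1.-homog ->
    lform A j = nth 0 [:: l0; l1; a1; - b1] j.
  move=> hj; rewrite [RHS]dhomog1_sum //.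
  by apply: eq_bigr => i _; rewrite mxE.
have E0 : lform A i0 = l0 by rewrite lA.
have E1 : lform A i1 = l1 by rewrite lA.
have Eqd : quad A = q by rewrite /quad E0 E1 !lA //= rpredN.
exists A; rewrite E0 E1 Eqd; split=> //.
by apply: quad_unitmx; rewrite Eqd.
Qed.

End NormalForm.

Theorem theorem1p3 (K : closedFieldType) (Q f : Rset K) (d : nat) (C : Rset K) :
  smooth_quadric Q -> line_on Q f -> (1 <= d)%N ->
  linear_system Q (div_mul Q d f) C ->
  exists (m : nat) (L : 'I_m -> Rset K) (e : 'I_m -> nat),
    (forall i j : 'I_m, i <> j -> ~ eqI (L i) (L j)) /\
    (forall i : 'I_m, line_on Q (L i) /\ same_ruling Q f (L i)) /\
    (forall i : 'I_m, (1 <= e i)%N) /\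
    (\sum_(i < m) e i)%N = d /\
    eqI C (ideal_add Q
      (\big[@ideal_mul K/unit_ideal]_(i < m) ideal_exp (L i) (e i))).
Proof.
move=> sQ fQ _; have [A [uA -> ->]] := quadric_normal_form sQ fQ.
move=> [[CC QC _] CE].
have [F [F0 hF ->]] := lin_equiv_contr uA CC QC CE.
have [c [s [c0 ss ->]]] := binary_factor hF F0.
pose t := in_tuple (undup s).
exists (size (undup s)), (fun i => rline A (tnth t i)), (fun i => count_mem (tnth t i) s).
split=> [i j ne /eqI_eq /(rline_inj uA) E|].
  apply: ne; apply/val_inj/eqP; move/eqP: E.
  by rewrite !(tnth_nth None) nth_uniq ?undup_uniq.
split=> [i|].
  split; first exact: rline_line_on.
  exists (fun L => exists o, L = rline A o); split; first exact: ruling_rline.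
    (* f is p = 0, the line with parameter 0 *)
    by exists (Some 0); rewrite /rline /= !scale0r !subr0.
  by exists (tnth t i).
split=> [i|]; first by rewrite -has_count has_pred1 -mem_undup mem_tnth.
split.
  rewrite -(big_tnth _ _ (undup s) predT (fun o => count_mem o s)) -ss -sum1_size.
  rewrite -[RHS]big_undup_iterop_count; apply: eq_bigr => o _.
  by rewrite Monoid.iteropE iter_addn_0 mul1n.
rewrite -(contr_prod uA _ _ c0).
rewrite -(big_tnth _ _ (undup s) predT (fun o => bform o ^+ count_mem o s)).
by rewrite -[X in c *: X]big_undup_iterop_count.
Qed.
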